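(* Let $G$ be a finite connected graph and let $x \in V(G)$. A set $S \subseteq V(G)$ is $x$-geodominating if and only if $\partial(x) \subseteq S$.
   Context: Graphs are simple. $d(u,v)$ denotes the shortest-path distance in $G$ and $N(v)$ the set of neighbours of $v$. The interval $I[u,v]$ is the set of vertices lying on some shortest $u$–$v$ path (geodesic). A vertex $y$ $x$-geodominates a vertex $u$ if $u \in I[x,y]$. A set $S \subseteq V(G)$ is $x$-geodominating if every vertex of $G$ is $x$-geodominated by some element of $S$, i.e. $V(G) = \bigcup_{s \in S} I[x,s]$. The boundary of $x$ is $\partial(x) = \{ v \in V(G) : d(x,w) \le d(x,v) \text{ for all } w \in N(v)\}$. *)

(* Defs.v *)
From mathcomp Require Import all_boot.

Set Implicit Arguments.
Unset Strict Implicit.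
Unset Printing Implicit Defensive.

(* A simple graph is a symmetric irreflexive adjacency relation on a finType. *)
Section Geodomination.

Variables (T : finType) (adj : rel T).

Definition simple_graph : Prop := symmetric adj /\ irreflexive adj.

Definition nbh (v : T) : {set T} := [set w | adj v w].

(* [u :: p] is the vertex sequence, so the length of the path is [size p]. *)
Definition is_path (u v : T) (p : seq T) : bool :=
  [&& path adj u p, uniq (u :: p) & last u p == v].

Definition connected_graph : Prop := forall u v, exists p, is_path u v p.

(* The least length of a u-v path. A path has fewer than #|T| edges, so the   *)
(* search bound is harmless; the value is #|T| when there is no u-v path.     *)
Definition dist (u v : T) : nat :=
  find (fun n => [exists p : n.-tuple T, is_path u v p]) (iota 0 #|T|).

Definition interval (u v : T) : {set T} :=
  [set w | [exists p : (dist u v).-tuple T,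
             is_path u v p && (w \in u :: p)]].

Definition geodominates (x y u : T) : bool := u \in interval x y.

Definition geodominating (x : T) (S : {set T}) : bool :=
  [forall u, exists s in S, geodominates x s u].

Definition boundary (x : T) : {set T} :=
  [set v | [forall w in nbh v, dist x w <= dist x v]].

End Geodomination.

(* Main.v *)
(** For [v] in [I[x,s]] distinct from [s], the successor of [v] on a geodesic
    through [v] is a neighbour farther from [x], so a boundary vertex is
    geodominated only by itself.  Conversely, among the vertices [v] that
    geodominate [u], one at maximal distance from [x] is a boundary vertex: a
    neighbour farther from [x] would extend the geodesic through [u]. *)

Require Import Defs.
From mathcomp Require Import all_boot.

Section Geodesics.

Variables (T : finType) (adj : rel T).

(** Cutting the loops out of a walk gives a path that is no longer, and [dist] is minimal among the
    lengths of paths. *)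
Lemma dist_le_size (u : T) (p : seq T) :
  path adj u p -> dist adj u (last u p) <= size p.
Proof.
case/shortenP=> q pq uq /(uniq_leq_size (subseq_uniq (subseq_cons q u) uq)).
apply: leq_trans; rewrite leqNgt; apply/negP=> lt_q.
(* As [u :: q] has no repetition, [size q] lies in the range searched by [dist]. *)
have q_lt : size q < #|T| by rewrite -[(size q).+1](card_uniqP uq) max_card.
have:= before_find 0 lt_q; rewrite nth_iota // add0n => /existsP; case.
by exists (in_tuple q); apply/and3P.
Qed.

(** A repeated vertex would allow a shortening to below the distance. *)
Lemma shortest_walk_is_path (u : T) (p : seq T) :
  path adj u p -> size p <= dist adj u (last u p) -> is_path adj u (last u p) p.
Proof.
move=> pp le_p; rewrite /is_path pp eqxx andbT andTb.
case/shortenP: (pp) le_p => q pq uq sqp le_p.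
apply: (leq_size_uniq uq); last exact: leq_trans le_p (dist_le_size _ _ pq).
by move=> y; rewrite !inE; case: eqP => //= _ /sqp.
Qed.

(** Without the [uniq] condition, geodesics can be cut and extended as plain walks. *)
Lemma intervalP (u v w : T) :
  reflect (exists p, [/\ path adj u p, last u p = v,
                         size p = dist adj u v & w \in u :: p])
          (w \in interval adj u v).
Proof.
rewrite inE; apply: (iffP existsP) => [[p /andP[/and3P[pp _ /eqP lp] wp]]|].
  by exists p; rewrite size_tuple.
case=> p [pp lp sz wp].
have p_path : is_path adj u v p.
  by rewrite -lp; apply: shortest_walk_is_path; rewrite // lp sz.
by exists (tcast sz (in_tuple p)); rewrite val_tcast p_path.
Qed.

Hypothesis adj_conn : connected_graph adj.

Lemma shortest_walk (u v : T) :
  exists p, [/\ path adj u p, last u p = v & size p = dist adj u v].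
Proof.
have [p /and3P[pp up /eqP lp]] := adj_conn u v.
have p_lt : size p < #|T| by rewrite -[(size p).+1](card_uniqP up) max_card.
(* A failed search would return [#|T|], so this bound says that the search succeeds. *)
have dist_lt : dist adj u v < #|T|.
  by apply: leq_ltn_trans p_lt; rewrite -lp dist_le_size.
have : has (fun n => [exists q : n.-tuple T, is_path adj u v q]) (iota 0 #|T|).
  by rewrite has_find size_iota.
move/(nth_find 0); rewrite -/(dist adj u v) nth_iota // add0n.
by case/existsP=> q /and3P[pq _ /eqP lq]; exists q; rewrite size_tuple.
Qed.

Lemma dist_cat (u v : T) (p : seq T) :
  path adj v p -> dist adj u (last v p) <= dist adj u v + size p.
Proof.
have [q [pq <- <-]] := shortest_walk u v.
by move=> pp; rewrite -last_cat -size_cat dist_le_size // cat_path pq.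
Qed.

Lemma interval_endpoint (u v : T) : v \in interval adj u v.
Proof.
have [p [pp lp sz]] := shortest_walk u v.
by apply/intervalP; exists p; split=> //; rewrite -lp mem_last.
Qed.

Lemma boundary_in_interval (x s v : T) :
  v \in boundary adj x -> v \in interval adj x s -> v = s.
Proof.
rewrite inE => /forallP v_bd /intervalP[p [pp lp sz vp]].
case/splitPl: vp pp lp sz => p1 [|w p3] lp1.
  by rewrite cats0 lp1.
rewrite cat_path last_cat size_cat lp1 /= => /and3P[pp1 vw pp3] lp sz.
have := v_bd w; rewrite inE vw /= => dw.
have dv : dist adj x v <= size p1 by rewrite -lp1 dist_le_size.
(* Reaching [s] through [w] costs at most [dist adj x w + size p3], while the geodesic has length
   [size p1 + 1 + size p3]; hence [size p1 < dist adj x w]. *)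
have := dist_cat x w p3 pp3; rewrite lp -sz leqNgt addnS ltnS leq_add2r.
by rewrite (leq_trans dw dv).
Qed.

Lemma interval_extend (x u v w : T) :
  u \in interval adj x v -> adj v w -> dist adj x v < dist adj x w ->
  u \in interval adj x w.
Proof.
move=> /intervalP[p [pp lp sz up]] vw lt_vw; apply/intervalP.
have pw : path adj x (rcons p w) by rewrite rcons_path pp lp.
exists (rcons p w); split=> //; first by rewrite last_rcons.
  (* The length [dist adj x v + 1] is at most [dist adj x w] by [lt_vw], and at least that since it
     is the length of a walk. *)
  apply/eqP; rewrite eqn_leq {1}size_rcons sz lt_vw.
  by have:= dist_le_size x _ pw; rewrite last_rcons.
by rewrite -rcons_cons mem_rcons inE up orbT.
Qed.

End Geodesics.

Theorem theorem1 (T : finType) (adj : rel T)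
    (adj_simple : simple_graph adj) (adj_conn : connected_graph adj)
    (x : T) (S : {set T}) :
  geodominating adj x S <-> boundary adj x \subset S.
Proof.
split=> [/forallP domS | /subsetP bdS].
  apply/subsetP=> v v_bd; have /exists_inP[s sS xsv] := domS v.
  by rewrite (boundary_in_interval _ _ adj_conn x s v v_bd xsv).
apply/forallP=> u; apply/exists_inP.
(* This makes the set of candidates for the maximum nonempty. *)
have u_dom : geodominates adj x u u := interval_endpoint _ _ adj_conn x u.
case: (arg_maxnP (P := fun v => geodominates adj x v u) (dist adj x) u_dom).
move=> v xvu v_max.
exists v => //; apply: bdS; rewrite inE; apply/forall_inP=> w; rewrite inE => vw.
rewrite leqNgt; apply/negP=> lt_vw.
have := v_max w (interval_extend _ _ x u v w xvu vw lt_vw).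
by rewrite /= leqNgt lt_vw.
Qed.
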